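(* Let $n\ge 2$ be an integer and let $L,\lambda_1,\dots,\lambda_n$ be positive real numbers. Let $C_1,\dots,C_n$ be simple closed rectifiable curves in $\mathbb{R}^2$ with respective arc lengths $L_1,\dots,L_n$ such that (1) $C_i\in[\lambda_i]$ for $i=1,\dots,n$; (2) $L_1+\dots+L_n=L$; (3) the bounded regions $G_1,\dots,G_n$ with respective boundaries $C_1,\dots,C_n$ are pairwise disjoint. Let $A_i$ be the area of $G_i$ and let $A=\sum_{i=1}^n A_i$ be the total area of $\bigcup_{i=1}^n G_i$. Then $A$ takes its smallest value (among all $n$-tuples of curves satisfying (1)--(3) with the same $n,L,\lambda_1,\dots,\lambda_n$) if and only if $$\lambda_1L_1=\lambda_2L_2=\dots=\lambda_nL_n .$$ In particular, writing $s_i=1/\lambda_i$ for $i=1,\dots,n$, at the minimum one has $$L_i=\frac{s_iL}{s_1+s_2+\dots+s_n},\qquad i=1,\dots,n,$$ and therefore the smallest value of $A$ is $$A_{\min}=\frac{L^2}{s_1+\dots+s_n}.$$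
   Context: For a simple closed rectifiable curve $C$ in the plane $\mathbb{R}^2$ with arc length $\ell$, let $a$ be the area of the bounded region with boundary $C$. For a positive real number $\lambda$, the curve $C$ is said to belong to the class $[\lambda]$ (written $C\in[\lambda]$) if $a=\lambda \ell^2$. *)

(* Defs.v *)
From HB Require Import structures.
From mathcomp Require Import all_boot all_order all_algebra.
From mathcomp Require Import all_classical all_reals all_analysis.

Set Implicit Arguments.
Unset Strict Implicit.
Unset Printing Implicit Defensive.

Import Order.TTheory GRing.Theory Num.Theory.
Import numFieldNormedType.Exports.

Local Open Scope classical_set_scope.
Local Open Scope ring_scope.

(* The norm of the library on R * R is the sup norm: it is used here only for
   the topology of the plane and for boundedness, not for lengths. *)
Definition euclidean_dist (R : realType) (p q : R * R) : R :=
  Num.sqrt ((p.1 - q.1) ^+ 2 + (p.2 - q.2) ^+ 2).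

(* Length of the polygonal line through the images by g of the points 0 :: s;
   same shape as [variation], which is restricted to real-valued functions. *)
Definition polygonal_length (R : realType) (g : R -> R * R) (s : seq R) : R :=
  let G := g \o nth 1 (0 :: s) in
  \sum_(0 <= k < size s) euclidean_dist (G k.+1) (G k).

Definition arc_length_ereal (R : realType) (g : R -> R * R) : \bar R :=
  ereal_sup [set (polygonal_length g s)%:E | s in itv_partition 0 1].

Definition rectifiable (R : realType) (g : R -> R * R) : Prop :=
  (arc_length_ereal g < +oo)%E.

(* Meaningful for rectifiable g, as [fine] sends +oo to 0. *)
Definition arc_length (R : realType) (g : R -> R * R) : R :=
  fine (arc_length_ereal g).

(* A closed curve is given by a parametrization on [0, 1]; the values of g
   outside of [0, 1] are irrelevant. *)
Definition simple_closed_curve (R : realType) (g : R -> R * R) : Prop :=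
  [/\ {within `[0, 1], continuous g},
      g 0 = g 1 &
      {in `[0, 1[ &, injective g}].

Definition trace (R : realType) (g : R -> R * R) : set (R * R) :=
  g @` `[0, 1].

Definition boundary (T : topologicalType) (A : set T) : set T :=
  closure A `\` interior A.

Definition bounded_region_with_boundary (R : realType)
    (C G : set (R * R)) : Prop :=
  [/\ G !=set0, open G, connected G, bounded_set G & boundary G = C].

(* "The" bounded region with boundary C.  When C is the trace of a simple
   closed curve, the Jordan curve theorem says that there is exactly one G such
   that [bounded_region_with_boundary C G]; the union below is then this G. *)
Definition enclosed_region (R : realType) (g : R -> R * R) : set (R * R) :=
  \bigcup_(G in bounded_region_with_boundary (trace g)) G.

Definition area (R : realType) (A : set (R * R)) : \bar R :=
  (@lebesgue_measure R \x @lebesgue_measure R)%E A.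

Definition in_class (R : realType) (lambda : R) (g : R -> R * R) : Prop :=
  area (enclosed_region g) = (lambda * arc_length g ^+ 2)%:E.

Definition admissible (R : realType) (n : nat) (L : R) (lambda : 'I_n -> R)
    (C : 'I_n -> R -> R * R) : Prop :=
  [/\ forall i, simple_closed_curve (C i) /\ rectifiable (C i),
      forall i, in_class (lambda i) (C i),
      \sum_(i < n) arc_length (C i) = L &
      trivIset setT (fun i => enclosed_region (C i))].

Definition total_area (R : realType) (n : nat) (C : 'I_n -> R -> R * R) :
    \bar R :=
  (\sum_(i < n) area (enclosed_region (C i)))%E.

Definition smallest_value (R : realType) (S : set (\bar R)) (m : \bar R) :
    Prop :=
  S m /\ lbound S m.

(* Main.v *)
Require Import Defs.
From HB Require Import structures.
From mathcomp Require Import all_boot all_order all_algebra.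
From mathcomp Require Import all_classical all_reals all_analysis.
From mathcomp Require Import measurable_realfun ring lra.

Set Implicit Arguments.
Unset Strict Implicit.
Unset Printing Implicit Defensive.

Import Order.TTheory GRing.Theory Num.Theory.
Import numFieldNormedType.Exports.

Local Open Scope classical_set_scope.
Local Open Scope ring_scope.

(** Since each curve lies in its class, the total area is a function of the
    lengths alone, [\sum_i lambda_i * L_i ^+ 2], so the question is to minimize
    a positive definite quadratic form on the hyperplane [\sum_i L_i = L].
    Completing the squares ([weighted_squares_deficit]) writes this form, on
    the hyperplane, as [L ^+ 2 / S] plus the nonnegative sum
    [\sum_i lambda_i * (L_i - s_i * L / S) ^+ 2], with [S] the sum of the [s_i].
    Hence [L ^+ 2 / S] is a lower bound, reached exactly when
    [L_i = s_i * L / S] for all [i], which is the condition that the products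
    [lambda_i * L_i] are all equal.

    What remains is geometric: some admissible family must have these lengths,
    otherwise the smallest value could be larger, or fail to exist.  The family
    at hand provides the shapes ([admissible_with_lengths]): a class is
    invariant under dilations, because lengths scale by [r] and areas by
    [r ^+ 2], so each curve can be dilated to the prescribed length, its own
    length being positive ([arc_length_gt0]).  The dilated regions may overlap;
    they are pulled apart by horizontal translations ([spread_dilations]),
    which is possible since the region enclosed by a curve is bounded
    ([enclosed_region_strip]).

    All this is read off the definition of the enclosed region as the union of
    the bounded connected open sets whose boundary is the trace: a dilation
    carries these sets to those of the dilated trace
    ([enclosed_region_dilation]), the union is open, hence measurable
    ([open_measurable_plane]), and all the sets of the union obey the bounds
    of the trace. *)

(** * Dilations and enclosed regions *)

Definition dilation (R : realType) (r : R) (v p : R * R) : R * R :=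
  (r * p.1 + v.1, r * p.2 + v.2).

Lemma dilationK (R : realType) (r : R) (v : R * R) : r != 0 ->
  cancel (dilation r v) (dilation r^-1 (- (r^-1 * v.1), - (r^-1 * v.2))).
Proof.
by move=> r0 [x y]; rewrite /dilation /= !mulrDr !addrK !mulrA mulVf// !mul1r.
Qed.

Lemma dilationVK (R : realType) (r : R) (v : R * R) : r != 0 ->
  cancel (dilation r^-1 (- (r^-1 * v.1), - (r^-1 * v.2))) (dilation r v).
Proof.
move=> r0 [x y]; rewrite /dilation /= !mulrDr !mulrN !mulrA divff//.
by rewrite !mul1r !subrK.
Qed.

Lemma continuous_dilation (R : realType) (r : R) (v : R * R) :
  continuous (dilation r v).
Proof.
move=> p.
have c1 : r * q.1 + v.1 @[q --> p] --> r * p.1 + v.1.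
  by apply: cvgD; [apply: cvgM; [exact: cvg_cst|exact: cvg_fst]|exact: cvg_cst].
have c2 : r * q.2 + v.2 @[q --> p] --> r * p.2 + v.2.
  by apply: cvgD; [apply: cvgM; [exact: cvg_cst|exact: cvg_snd]|exact: cvg_cst].
exact: (cvg_pair c1 c2).
Qed.

Lemma image_cancel (T U : Type) (f : T -> U) (g : U -> T) (A : set T) :
  cancel f g -> cancel g f -> f @` A = g @^-1` A.
Proof.
move=> fK gK; apply/seteqP; split=> [_ [x Ax <-]|x Ax]; first by rewrite /= fK.
by exists (g x).
Qed.

Lemma preimage_interior (T U : topologicalType) (f : T -> U) (A : set U) :
  continuous f -> f @^-1` interior A `<=` interior (f @^-1` A).
Proof.
move=> /continuousP cf; rewrite -open_subsetE.
  by apply: preimage_subset; exact: interior_subset.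
by apply: cf; exact: open_interior.
Qed.

(** For a homeomorphism the inclusion above, used for [f] and for its inverse
    [g], becomes an equality. *)
Lemma interior_preimage (T U : topologicalType) (f : T -> U) (g : U -> T)
    (A : set U) : continuous f -> continuous g -> cancel f g -> cancel g f ->
  interior (f @^-1` A) = f @^-1` interior A.
Proof.
move=> cf cg fK gK; apply/seteqP; split; last exact: preimage_interior.
move=> x xA; have := @preimage_interior _ _ g (f @^-1` A) cg (f x).
rewrite /= fK => /(_ xA).
by rewrite -comp_preimage (_ : f \o g = id) ?preimage_id//; apply/funext.
Qed.

Lemma boundary_preimage (T U : topologicalType) (f : T -> U) (g : U -> T)
    (A : set U) : continuous f -> continuous g -> cancel f g -> cancel g f ->
  boundary (f @^-1` A) = f @^-1` boundary A.
Proof.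
move=> cf cg fK gK; rewrite /boundary (interior_preimage _ cf cg)//.
rewrite (_ : closure (f @^-1` A) = f @^-1` closure A)//.
have := interior_preimage (~` A) cf cg fK gK.
by rewrite -preimage_setC !interiorC -preimage_setC => /(can_inj setCK).
Qed.

Lemma bounded_dilation (R : realType) (r : R) (v : R * R) (A : set (R * R)) :
  bounded_set A -> bounded_set (dilation r v @` A).
Proof.
move=> [M [Mr MA]].
pose N := `|r| * (M + 1) + `|v.1| + `|v.2|.
exists N; split; first exact: num_real.
move=> K NK _ [p Ap <-]; apply: le_trans (ltW NK).
have : `|p| <= M + 1 by apply: MA => //; rewrite ltrDl.
rewrite !prod_normE /= !ge_max => /andP[p1 p2].
have H a b : `|a| <= M + 1 -> `|r * a + b| <= `|r| * (M + 1) + `|b|.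
  move=> aM; apply: le_trans (ler_normD _ _) _.
  by rewrite lerD2r normrM ler_wpM2l.
apply/andP; split.
- by apply: le_trans (H _ _ p1) _; rewrite lerDl.
- by apply: le_trans (H _ _ p2) _; rewrite /N lerD2r lerDl.
Qed.

Lemma bounded_region_dilation (R : realType) (r : R) (v : R * R)
    (C G : set (R * R)) :
  r != 0 -> bounded_region_with_boundary C G ->
  bounded_region_with_boundary (dilation r v @` C) (dilation r v @` G).
Proof.
move=> r0 [G0 oG cG bG <-].
have fK := dilationK v r0; have gK := dilationVK v r0.
split.
- by case: G0 => p Gp; exists (dilation r v p); exists p.
- rewrite (image_cancel _ fK gK).
  by apply: open_comp => // p _; exact: continuous_dilation.
- apply: connected_continuous_connected => //.
  by apply: continuous_subspaceT; exact: continuous_dilation.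
- exact: bounded_dilation.
- rewrite !(image_cancel _ fK gK) (boundary_preimage _ _ _ gK fK) //;
    exact: continuous_dilation.
Qed.

Lemma trace_comp (R : realType) (f : R * R -> R * R) (g : R -> R * R) :
  trace (f \o g) = f @` trace g.
Proof. by rewrite /trace -image_comp. Qed.

(** The dilation and its inverse, which is also a dilation, exchange the sets of
    the two unions. *)
Lemma enclosed_region_dilation (R : realType) (r : R) (v : R * R)
    (g : R -> R * R) :
  r != 0 ->
  enclosed_region (dilation r v \o g) = dilation r v @` enclosed_region g.
Proof.
move=> r0; have fK := dilationK v r0; have gK := dilationVK v r0.
apply/seteqP; split=> [p [G]|_ [p [G GC Gp] <-]]; last first.
  exists (dilation r v @` G); last by exists p.
  by rewrite trace_comp; exact: bounded_region_dilation.
rewrite /= trace_comp => GC Gp.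
exists (dilation r^-1 (- (r^-1 * v.1), - (r^-1 * v.2)) p); last exact: gK.
exists (dilation r^-1 (- (r^-1 * v.1), - (r^-1 * v.2)) @` G); last by exists p.
rewrite /= -(_ : dilation r^-1 (- (r^-1 * v.1), - (r^-1 * v.2)) @`
    (dilation r v @` trace g) = trace g).
  by apply: bounded_region_dilation; rewrite ?invr_eq0.
by rewrite image_comp (_ : _ \o _ = id) ?image_id//; apply/funext.
Qed.

Lemma open_enclosed_region (R : realType) (g : R -> R * R) :
  open (enclosed_region g).
Proof. by apply: bigcup_open => G []. Qed.

(** * Areas *)

(* [R * R] with the product sigma-algebra on which [area] is defined. *)
Local Notation plane R := (measurableTypeR R * measurableTypeR R)%type.

Lemma measurable_affine (R : realType) (r c : R) :
  measurable_fun setT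
    (fun x : measurableTypeR R => r * x + c : measurableTypeR R).
Proof.
by apply: measurable_funD => //; exact: measurable_funM.
Qed.

(** The right-hand side is a measure in [A], so by uniqueness of the Lebesgue
    measure it is enough to compare the two sides on half-open intervals. *)
Lemma lebesgue_measure_affine (R : realType) (r c : R) (A : set R) : 0 < r ->
  measurable (A : set (measurableTypeR R)) ->
  (lebesgue_measure A =
    r%:E * lebesgue_measure ((fun x => (r * x + c)%R) @^-1` A))%E.
Proof.
move=> r0 mA.
have mf := measurable_affine r c.
pose f := fun x : measurableTypeR R => r * x + c : measurableTypeR R.
transitivity
  (pushforward (mscale (NngNum (ltW r0)) lebesgue_measure) f A) => //.
apply: lebesgue_measure_unique => // _ [[a b]] _ <-.
rewrite [RHS]/(r%:E * lebesgue_measure (f @^-1` `]a, b]))%E.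
rewrite (_ : _ @^-1` _ = `](a - c) / r, (b - c) / r]%classic); last first.
  apply/seteqP; split => x /=; rewrite !in_itv /= /f => /andP[ax xb];
    apply/andP; split.
  - by rewrite ltr_pdivrMr// mulrC ltrBlDr.
  - by rewrite ler_pdivlMr// mulrC lerBrDr.
  - by move: ax; rewrite ltr_pdivrMr// mulrC ltrBlDr.
  - by move: xb; rewrite ler_pdivlMr// mulrC lerBrDr.
rewrite !lebesgue_measure_itv /= !lte_fin ltr_pM2r ?invr_gt0// ltrD2r.
case: ifPn => _ /=; last by rewrite mulr0.
by congr EFin; field; rewrite gt_eqF.
Qed.

Lemma measurable_dilation (R : realType) (r : R) (v : R * R) :
  measurable_fun [set: plane R] (dilation r v : plane R -> plane R).
Proof.
apply/measurable_fun_pairP; split.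
- exact: (measurableT_comp (measurable_affine r v.1) measurable_fst).
- exact: (measurableT_comp (measurable_affine r v.2) measurable_snd).
Qed.

(** The sigma-algebra on the plane is the product one, so measurable rectangles
    are what it offers; an open set is the countable union of the open boxes
    with rational corners that it contains. *)
Lemma open_measurable_plane (R : realType) (U : set (R * R)) : open U ->
  measurable (U : set (plane R)).
Proof.
move=> oU.
pose box (i : (rat * rat) * (rat * rat)) : set (R * R) :=
  `]ratr i.1.1, ratr i.1.2[ `*` `]ratr i.2.1, ratr i.2.2[.
have -> : U = \bigcup_i (if `[< box i `<=` U >] then box i else set0).
  apply/seteqP; split => [p Up|p [i _]]; last by case: asboolP => [bU /bU|].
  have [e /= e0 eU] : nbhs_ball p U.
    by rewrite nbhs_ballE; exact: open_nbhs_nbhs.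
  have rat_near (x : R) : exists q : rat * rat,
      x - e < ratr q.1 < x /\ x < ratr q.2 < x + e.
    have [|q1] := @rat_in_itvoo R (x - e) x; first by rewrite ltrBlDr ltrDl.
    have [|q2] := @rat_in_itvoo R x (x + e); first by rewrite ltrDl.
    by rewrite !in_itv /=; exists (q1, q2).
  have [q [/andP[q1 q1p] /andP[pq2 q2]]] := rat_near p.1.
  have [q' [/andP[q1' q1p'] /andP[pq2' q2']]] := rat_near p.2.
  exists (q, q') => //; rewrite ifT.
    by split => /=; rewrite in_itv /=; apply/andP.
  apply/asboolP => -[x y] [] /=; rewrite !in_itv /=.
  move=> /andP[x1 x2] /andP[y1 y2].
  by apply: eU; split; rewrite /= -ball_normE /ball_/= ltr_distlC; lra.
apply: countable_bigcupT_measurable => // i; case: ifP => // _.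
by apply: measurableX; exact: measurable_itv.
Qed.

(** Same principle in the plane: the right-hand side is a measure in [A], and
    a measure is the product measure as soon as it is right on rectangles. *)
Lemma area_dilation (R : realType) (r : R) (v : R * R)
    (A : set (R * R)) : 0 < r ->
  measurable (A : set (plane R)) ->
  (area A = (r ^+ 2)%:E * area (dilation r v @^-1` A))%E.
Proof.
move=> r0 mA.
have mf := measurable_dilation r v.
have r20 : 0 <= r ^+ 2 by exact: sqr_ge0.
transitivity
  (pushforward (mscale (NngNum r20) (lebesgue_measure \x lebesgue_measure)%E)
     (dilation r v : plane R -> plane R) A) => //.
apply: product_measure_unique => // X Y mX mY.
rewrite [LHS]/((r ^+ 2)%:E *
  (lebesgue_measure \x lebesgue_measure) (dilation r v @^-1` (X `*` Y)))%E.
rewrite (_ : _ @^-1` _ =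
  ((fun x => r * x + v.1) @^-1` X) `*` ((fun x => r * x + v.2) @^-1` Y))//.
rewrite product_measure1E//; last 2 first.
- by rewrite -[X in measurable X]setTI; exact: measurable_affine.
- by rewrite -[X in measurable X]setTI; exact: measurable_affine.
apply: etrans (congr2 mule (esym (lebesgue_measure_affine v.1 r0 mX))
                           (esym (lebesgue_measure_affine v.2 r0 mY))).
by rewrite muleACA -EFinM -expr2.
Qed.

Lemma area_enclosed_region_dilation (R : realType) (r : R) (v : R * R)
    (g : R -> R * R) : 0 < r ->
  area (enclosed_region (dilation r v \o g)) =
  ((r ^+ 2)%:E * area (enclosed_region g))%E.
Proof.
move=> r0; have fK := dilationK v (lt0r_neq0 r0).
rewrite (area_dilation v r0) ?enclosed_region_dilation ?gt_eqF//; last first.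
  rewrite -enclosed_region_dilation ?gt_eqF//.
  by apply: open_measurable_plane; exact: open_enclosed_region.
congr (_ * area _)%E; apply/seteqP; split => [p [q Aq /(can_inj fK) <-]//|p Ap].
by exists p.
Qed.

(** * Boundedness of the enclosed region *)

(** A point of [G] beyond the vertical line of abscissa [M] would start a
    horizontal ray which has to leave the bounded set [G], and the last point of
    the ray in the closure of [G] would be a boundary point beyond that line. *)
Lemma bounded_region_right (R : realType) (M : R) (C G : set (R * R)) :
  (forall c, C c -> c.1 <= M) -> bounded_region_with_boundary C G ->
  forall p, G p -> p.1 <= M.
Proof.
move=> CM [_ oG _ [B [_ GB]] bG] [x y] Gxy; rewrite leNgt; apply/negP => /= Mx.
pose S := [set t | G (t, y)].
have supS : has_sup S.
  split; first by exists x.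
  have B1 : B < B + 1 by rewrite ltrDl.
  exists (B + 1) => t St.
  have : `|(t, y)| <= B + 1 by exact: GB St.
  by rewrite prod_normE /= ge_max => /andP[/(le_trans (ler_norm t))].
have Ms : M < sup S by apply: lt_le_trans Mx _; apply: sup_upper_bound.
suff : C (sup S, y) by move=> /CM /=; rewrite leNgt Ms.
rewrite -bG; split.
- move=> V /nbhs_ballP[e /= e0 eV].
  have [t St st] := sup_adherent e0 supS.
  have ts := sup_upper_bound supS St.
  exists (t, y); split => //; apply: eV; split => //=; last exact: ballxx.
  by rewrite -ball_normE /ball_ /= ger0_norm; lra.
- move/nbhs_ballP => [e /= e0 eG].
  suff /(sup_upper_bound supS) : S (sup S + e / 2) by lra.
  apply: eG; split => //=; last exact: ballxx.
  by rewrite -ball_normE /ball_ /= ler0_norm; lra.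
Qed.

(** The bound is uniform over all bounded regions with boundary the trace: it is
    any bound for the trace, which is compact. *)
Lemma enclosed_region_strip (R : realType) (g : R -> R * R) :
  {within `[0, 1], continuous g} ->
  exists M, forall p, enclosed_region g p -> `|p.1| <= M.
Proof.
move=> cg.
have [B [_ gB]] := compact_bounded
  (continuous_compact cg (@segment_compact R 0 1)).
have gle c : trace g c -> `|c.1| <= B + 1.
  have B1 : B < B + 1 by rewrite ltrDl.
  move=> gc; have : `|c| <= B + 1 by exact: gB gc.
  by rewrite prod_normE ge_max => /andP[].
exists (B + 1) => p [G GC Gp]; rewrite ler_norml; apply/andP; split; last first.
  by apply: (bounded_region_right _ GC Gp) => c /gle cB;
    apply: le_trans (ler_norm _) cB.
(* The bound on the left is the bound on the right for the image by the point
   reflection at the origin, which is a dilation of ratio -1. *)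
have N1 : (-1 : R) != 0 by rewrite oppr_eq0 oner_neq0.
have H c : (dilation (-1) (0, 0) @` trace g) c -> c.1 <= B + 1.
  move=> [d /gle dB <-] /=; rewrite addr0 mulN1r; apply: le_trans dB.
  by rewrite -normrN ler_norm.
have /= := bounded_region_right H (bounded_region_dilation (0, 0) N1 GC)
  (imageP _ Gp).
by rewrite addr0 mulN1r lerNl.
Qed.

(** * Curves and their lengths *)

Lemma euclidean_dist_dilation (R : realType) (r : R) (v p q : R * R) : 0 <= r ->
  euclidean_dist (dilation r v p) (dilation r v q) = r * euclidean_dist p q.
Proof.
move=> r0; rewrite /euclidean_dist /dilation /=.
rewrite -[r in RHS]ger0_norm// -sqrtr_sqr -sqrtrM ?sqr_ge0//; congr Num.sqrt.
by ring.
Qed.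

Lemma arc_length_ereal_dilation (R : realType) (r : R) (v : R * R)
    (g : R -> R * R) :
  0 < r ->
  arc_length_ereal (dilation r v \o g) = (r%:E * arc_length_ereal g)%E.
Proof.
move=> r0; rewrite /arc_length_ereal -ereal_sup_pZl// image_comp.
congr ereal_sup; apply: eq_imagel => s _ /=.
rewrite -EFinM /polygonal_length mulr_sumr; congr EFin.
by apply: eq_bigr => k _; rewrite /= euclidean_dist_dilation ?ltW.
Qed.

Lemma rectifiable_dilation (R : realType) (r : R) (v : R * R)
    (g : R -> R * R) :
  0 < r -> rectifiable g -> rectifiable (dilation r v \o g).
Proof.
move=> r0 rg; rewrite /rectifiable arc_length_ereal_dilation//.
by rewrite lte_mul_pinfty ?lee_fin ?ltW.
Qed.

Lemma arc_length_dilation (R : realType) (r : R) (v : R * R)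
    (g : R -> R * R) :
  0 < r -> arc_length (dilation r v \o g) = r * arc_length g.
Proof.
move=> r0; rewrite /arc_length arc_length_ereal_dilation//.
case: (arc_length_ereal g) => [x||] //=.
- by rewrite mulry gtr0_sg// mul1e mulr0.
- by rewrite mulrNy gtr0_sg// mul1e mulr0.
Qed.

Lemma simple_closed_curve_dilation (R : realType) (r : R) (v : R * R)
    (g : R -> R * R) : r != 0 ->
  simple_closed_curve g -> simple_closed_curve (dilation r v \o g).
Proof.
move=> r0 [cg g01 ig]; split.
- by apply: within_continuous_comp cg => p _; exact: continuous_dilation.
- by rewrite /= g01.
- by move=> x y x01 y01 /= /(can_inj (dilationK v r0)); exact: ig.
Qed.

Lemma euclidean_dist_gt0 (R : realType) (p q : R * R) : p != q ->
  0 < euclidean_dist p q.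
Proof.
move=> pq; rewrite sqrtr_gt0 lt_neqAle addr_ge0 ?sqr_ge0// andbT eq_sym.
rewrite paddr_eq0 ?sqr_ge0// !sqrf_eq0 !subr_eq0.
by rewrite -xpair_eqE -!surjective_pairing.
Qed.

(** A simple curve is at two distinct points at the times 0 and 1/2, so the
    inscribed polygonal line through these two points already has positive
    length. *)
Lemma arc_length_gt0 (R : realType) (g : R -> R * R) :
  simple_closed_curve g -> rectifiable g -> 0 < arc_length g.
Proof.
move=> [_ g01 ig] rg.
have gh : g 2^-1 != g 0.
  apply/eqP => /ig; rewrite !in_itv /= => H.
  have : (2^-1 : R) = 0 by apply: H; lra.
  by lra.
have P : itv_partition 0 1 [:: 2^-1; 1 : R].
  by split => //=; apply/and3P; split => //; lra.
have len : ((polygonal_length g [:: 2^-1; 1])%:E <= arc_length_ereal g)%E.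
  by apply: ereal_sup_ubound; exists [:: 2^-1; 1].
have pos : 0 < polygonal_length g [:: 2^-1; 1].
  rewrite /polygonal_length big_mkord !big_ord_recl big_ord0 /= addr0.
  by rewrite ltr_wpDr ?sqrtr_ge0// euclidean_dist_gt0.
apply: fine_gt0; apply/andP; split; last exact: rg.
by apply: lt_le_trans len; rewrite lte_fin.
Qed.

(** Dilated about the origin, each region lies in the vertical strip of points
    whose abscissa is less than a common constant [K] in absolute value;
    translating the strips by the multiples of [2 * K] makes them disjoint. *)
Lemma spread_dilations (R : realType) (n : nat) (C : 'I_n -> R -> R * R)
    (r : 'I_n -> R) :
  (forall i, 0 < r i) -> (forall i, {within `[0, 1], continuous (C i)}) ->
  exists v : 'I_n -> R * R,
    trivIset setT (fun i => enclosed_region (dilation (r i) (v i) \o C i)).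
Proof.
move=> r0 cC; have [M CM] := choice (fun i => enclosed_region_strip (cC i)).
pose K := 1 + \sum_i r i * `|M i|.
have rK i : r i * `|M i| < K.
  rewrite /K (bigD1 i)//= addrCA ltrDl ltr_pwDl ?ltr01// sumr_ge0// => j _.
  by rewrite mulr_ge0// ltW.
exists (fun i => (2 * K * i%:R, 0)); apply/trivIsetP => i j _ _.
apply: contraNeq => /set0P[p []].
have rn0 k : r k != 0 by exact: lt0r_neq0.
rewrite !enclosed_region_dilation// => -[q Cq <-] [q' Cq' [/= e _]].
have near k z : enclosed_region (C k) z -> `|r k * z.1| < K.
  move=> Cz; rewrite normrM gtr0_norm//; apply: le_lt_trans (rK k).
  by rewrite ler_pM2l// (le_trans (CM k z Cz)) ?ler_norm.
have K0 : 0 < K by apply: le_lt_trans (rK i); rewrite mulr_ge0// ltW.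
(* A common point would put the axes of two strips at distance less than
   [2 * K], that is, two distinct integers at distance less than 1. *)
have : `|(2 * K) * (i%:R - j%:R)| < (2 * K) * 1.
  have := near _ _ Cq; have := near _ _ Cq'; rewrite !ltr_norml.
  by move=> /andP[a b] /andP[c d]; rewrite mulrBr; lra.
rewrite normrM gtr0_norm ?mulr_gt0// ltr_pM2l ?mulr_gt0//.
rewrite ltr_norml => /andP[ji ij].
have [ltij|ltji|/val_inj->//] := ltngtP (val i) (val j).
- by have := ltij; rewrite -(ler_nat R) -natr1 /=; lra.
- by have := ltji; rewrite -(ler_nat R) -natr1 /=; lra.
Qed.

(** * The minimization problem *)

(** The Cauchy-Schwarz inequality with its equality case made explicit: for
    positive weights the deficit is a sum of nonnegative terms, which vanishes
    only when every [x i] equals [(l i)^-1 * m]. *)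
Lemma weighted_squares_deficit (R : realFieldType) (n : nat) (l x : 'I_n -> R) :
  (forall i, l i != 0) -> \sum_i (l i)^-1 != 0 ->
  let m := (\sum_i x i) / \sum_i (l i)^-1 in
  \sum_i l i * x i ^+ 2 =
  (\sum_i x i) ^+ 2 / \sum_i (l i)^-1 + \sum_i l i * (x i - (l i)^-1 * m) ^+ 2.
Proof.
move=> l0 S0 m.
(* Completing the square in [l i * x i ^+ 2] leaves
   [2 * m * x i - m ^+ 2 / l i], and by the choice of [m] these remainders add
   up to the main term. *)
transitivity (\sum_i (2 * m * x i - m ^+ 2 * (l i)^-1 +
  l i * (x i - (l i)^-1 * m) ^+ 2)).
  by apply: eq_bigr => i _; field.
rewrite big_split sumrB -!mulr_sumr /=; congr +%R.
by rewrite /m; field.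
Qed.

Lemma total_area_admissible (R : realType) (n : nat) (L : R)
    (lambda : 'I_n -> R) (C : 'I_n -> R -> R * R) : admissible L lambda C ->
  total_area C = (\sum_i lambda i * arc_length (C i) ^+ 2)%:E.
Proof.
by move=> [_ CL _ _]; rewrite -sumEFin; apply: eq_bigr => i _; exact: CL.
Qed.

(** One admissible family yields all others that are needed: its curves are
    dilated to the prescribed lengths, which does not change their classes, and
    then spread apart. *)
Lemma admissible_with_lengths (R : realType) (n : nat) (L : R)
    (lambda : 'I_n -> R) (C : 'I_n -> R -> R * R) (l : 'I_n -> R) :
  admissible L lambda C -> (forall i, 0 < l i) -> \sum_i l i = L ->
  exists2 D, admissible L lambda D & forall i, arc_length (D i) = l i.
Proof.
move=> [Ccurve CL _ _] l0 lL.
have aC i : 0 < arc_length (C i) by case: (Ccurve i); exact: arc_length_gt0.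
pose r i := l i / arc_length (C i).
have r0 i : 0 < r i by exact: divr_gt0.
have cC i : {within `[0, 1], continuous (C i)} by case: (Ccurve i) => -[].
have [v vD] := spread_dilations r0 cC.
have lD i : arc_length (dilation (r i) (v i) \o C i) = l i.
  by rewrite arc_length_dilation// divfK// gt_eqF.
exists (fun i => dilation (r i) (v i) \o C i) => //; split => //.
- move=> i; have [sC rC] := Ccurve i; split; last exact: rectifiable_dilation.
  by apply: simple_closed_curve_dilation => //; rewrite gt_eqF.
- move=> i; rewrite /in_class area_enclosed_region_dilation// CL lD -EFinM.
  by rewrite mulrCA -exprMn divfK// gt_eqF.
- by rewrite (eq_bigr l).
Qed.

Theorem proposition5 (R : realType) (n : nat) (hn : (2 <= n)%N)
    (L : R) (hL : 0 < L)
    (lambda : 'I_n -> R) (hlambda : forall i, 0 < lambda i)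
    (C : 'I_n -> R -> R * R) (hC : admissible L lambda C) :
  let s := fun i => 1 / lambda i in
  let areas := [set total_area D | D in admissible L lambda] in
  [/\ smallest_value areas (total_area C) <->
        (forall i j, lambda i * arc_length (C i) = lambda j * arc_length (C j)),
      smallest_value areas (total_area C) ->
        forall i, arc_length (C i) = s i * L / \sum_(j < n) s j &
      smallest_value areas (L ^+ 2 / \sum_(j < n) s j)%:E].
Proof.
move=> s areas.
have l0 i : lambda i != 0 by exact: lt0r_neq0.
have s0 i : 0 < s i by rewrite divr_gt0.
have S0 : 0 < \sum_j s j.
  case: n hn lambda hlambda C hC s areas l0 s0 => // n _ ? _ ? _ s _ _ s0.
  by rewrite big_ord_recl ltr_wpDr// sumr_ge0// => j _; exact: ltW.
set S := \sum_j s j in S0 *.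
have areaE D : admissible L lambda D -> total_area D =
    (L ^+ 2 / S + \sum_i lambda i * (arc_length (D i) - s i * L / S) ^+ 2)%:E.
  move=> aD; have [_ _ DL _] := aD; rewrite (total_area_admissible aD).
  have sE : \sum_i (lambda i)^-1 = S by apply: eq_bigr => i _; rewrite /s div1r.
  rewrite weighted_squares_deficit ?sE ?gt_eqF// DL; congr (_ + _)%:E.
  by apply: eq_bigr => i _; rewrite /s div1r -!mulrA.
have deficit0 D i : 0 <= lambda i * (arc_length (D i) - s i * L / S) ^+ 2.
  by rewrite mulr_ge0 ?sqr_ge0// ltW.
have Amin : smallest_value areas (L ^+ 2 / S)%:E.
  split; last first.
    by move=> _ [D aD <-]; rewrite (areaE D aD) lee_fin lerDl sumr_ge0.
  have sL : \sum_i s i * L / S = L.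
    by rewrite -!mulr_suml mulrAC divff ?mul1r// gt_eqF.
  have [|D aD DL] := admissible_with_lengths hC _ sL.
    by move=> i; rewrite divr_gt0// mulr_gt0.
  exists D => //; rewrite (areaE D aD) big1 ?addr0// => i _.
  by rewrite DL subrr expr0n mulr0.
have lengths : smallest_value areas (total_area C) ->
    forall i, arc_length (C i) = s i * L / S.
  move=> [_ /(_ _ Amin.1)]; rewrite (areaE C hC) lee_fin gerDl => le0 i.
  have /eqP := le_anti (introT andP
    (conj le0 (sumr_ge0 _ (fun i _ => deficit0 C i)))).
  rewrite psumr_eq0// => /allP/(_ i (mem_index_enum i)) /=.
  by rewrite mulf_eq0 (negbTE (l0 i)) sqrf_eq0 subr_eq0 => /eqP.
split => //; split=> [/lengths CL i j|eqC].
  by rewrite !CL /s -!mulrA !mul1r !mulrA !divff.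
have [_ _ CL _] := hC.
have CE i : arc_length (C i) = s i * L / S.
  have : L = S * (lambda i * arc_length (C i)).
    rewrite -CL mulr_suml; apply: eq_bigr => j _.
    by rewrite (eqC i j) /s mulrA div1r mulVf ?mul1r.
  by move=> ->; rewrite /s; field; rewrite l0 gt_eqF.
rewrite (areaE C hC) big1 ?addr0// => i _.
by rewrite CE subrr expr0n mulr0.
Qed.
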